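(* Let $\mathcal{H}$ be a complex Hilbert space, let $\alpha\in[0,1]$, and let $X\in\mathcal{B}(\mathcal{H})$. Then $$\left\|\begin{pmatrix}0&X\\0&0\end{pmatrix}\right\|_{\alpha}=\begin{cases}\dfrac{1}{2\sqrt{\alpha}}\,\|X\| & \text{if } \alpha>\frac12,\\[2mm] \sqrt{1-\alpha}\,\|X\| & \text{if } \alpha\le\frac12.\end{cases}$$
   Context: For a complex Hilbert space $\mathcal{K}$, $\mathcal{B}(\mathcal{K})$ denotes the bounded linear operators on $\mathcal{K}$ and $\|T\|$ the usual operator norm. For $\alpha\in[0,1]$ and $T\in\mathcal{B}(\mathcal{K})$, the $\alpha$-norm of $T$ is $\|T\|_{\alpha}=\sup\left\{\sqrt{\alpha|\langle Tx,x\rangle|^2+(1-\alpha)\|Tx\|^2}: x\in\mathcal{K},\ \|x\|=1\right\}$. A $2\times2$ matrix with entries in $\mathcal{B}(\mathcal{H})$ acts on the Hilbert space direct sum $\mathcal{H}\oplus\mathcal{H}$ (column vectors) in the usual way. *)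

(* Defs.v *)
From HB Require Import structures.
From mathcomp Require Import all_boot all_order all_algebra.
From mathcomp.real_closed Require Import complex.
From mathcomp Require Import all_classical all_reals all_analysis.
From mathcomp Require Import ring.

Set Implicit Arguments.
Unset Strict Implicit.
Unset Printing Implicit Defensive.

Import Order.TTheory GRing.Theory Num.Theory.
Import numFieldNormedType.Exports.

Local Open Scope classical_set_scope.
Local Open Scope ring_scope.

(* The inner product is linear in its first argument and conjugate-linear in
   the second one.  Positive-definiteness and compatibility with the norm of
   the underlying complete normed module make that norm the Hilbert norm. *)
HB.mixin Record CompleteNormedModule_isHilbert (R : realType) V
    & CompleteNormedModule R[i] V := {
  inner : {dot V for @Num.conj R[i]};
  sqr_norm_inner : forall x : V, `|x| ^+ 2 = inner x x
}.

#[short(type="hilbertType")]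
HB.structure Definition Hilbert (R : realType) :=
  {V of CompleteNormedModule R[i] V & CompleteNormedModule_isHilbert R V}.

Section RealNorm.
Variables (R : realType) (V : normedZmodType R[i]).

(* Norms over R[i], including the modulus on R[i] itself, are R[i]-valued
   (with zero imaginary part); rnorm is the same number seen in R. *)
Definition rnorm (x : V) : R := complex.Re `|x|.

Lemma rnormE (x : V) : (rnorm x)%:C%C = `|x|.
Proof. by rewrite /rnorm RRe_real// ger0_real. Qed.

Lemma rnorm_ge0 (x : V) : 0 <= rnorm x.
Proof. by rewrite -lecR rnormE; exact: normr_ge0. Qed.

Lemma ler_rnormD (x y : V) : rnorm (x + y) <= rnorm x + rnorm y.
Proof. by rewrite -lecR rmorphD/= !rnormE; exact: ler_normD. Qed.

End RealNorm.

Section HilbertSum.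
Variables (R : realType) (U V : hilbertType R).

(* The alias keeps the sum apart from the library's product U * V, which
   carries the max norm. *)
Definition hsum : Type := (U * V)%type.

HB.instance Definition _ := GRing.Lmodule.copy hsum (U * V)%type.

Definition hsum_inner (p q : hsum) : R[i] := inner p.1 q.1 + inner p.2 q.2.

Definition hsum_norm (p : hsum) : R[i] := sqrtC (`|p.1| ^+ 2 + `|p.2| ^+ 2).

Let sum_ge0 (p : hsum) : 0 <= `|p.1| ^+ 2 + `|p.2| ^+ 2.
Proof. by rewrite addr_ge0// exprn_ge0. Qed.

Let hsum_norm_ge0 (p : hsum) : 0 <= hsum_norm p.
Proof. by rewrite /hsum_norm sqrtC_ge0. Qed.

Let hsum_normD (p q : hsum) : hsum_norm (p + q) <= hsum_norm p + hsum_norm q.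
Proof.
have ler_sq (a b : R[i]) : 0 <= a -> 0 <= b -> a ^+ 2 <= b ^+ 2 -> a <= b.
  by move=> a0 b0; rewrite ler_pXn2r ?nnegrE.
apply: (ler_sq _ _); [by []|by rewrite addr_ge0|].
rewrite sqrrD /hsum_norm !sqrtCK.
set a := `|p.1|; set b := `|p.2|; set c := `|q.1|; set d := `|q.2|.
have [a0 b0 c0 d0] : [/\ 0 <= a, 0 <= b, 0 <= c & 0 <= d].
  by split; exact: normr_ge0.
apply: (@le_trans _ _ ((a + c) ^+ 2 + (b + d) ^+ 2)).
  by apply: lerD; rewrite ler_pXn2r// ?nnegrE ?addr_ge0//; exact: ler_normD.
have le_dot : a * c + b * d <= sqrtC (a ^+ 2 + b ^+ 2) * sqrtC (c ^+ 2 + d ^+ 2).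
  apply: (ler_sq _ _).
  - by rewrite addr_ge0// mulr_ge0.
  - by rewrite mulr_ge0// sqrtC_ge0 addr_ge0// exprn_ge0.
  rewrite exprMn !sqrtCK -subr_ge0.
  have -> : (a ^+ 2 + b ^+ 2) * (c ^+ 2 + d ^+ 2) - (a * c + b * d) ^+ 2 =
    (a * d - b * c) ^+ 2 by ring.
  apply: real_exprn_even_ge0 => //.
  by rewrite realB// ger0_real// mulr_ge0.
rewrite -subr_ge0; set m := sqrtC _ * sqrtC _ in le_dot *.
have -> : a ^+ 2 + b ^+ 2 + m *+ 2 + (c ^+ 2 + d ^+ 2) -
  ((a + c) ^+ 2 + (b + d) ^+ 2) = (m - (a * c + b * d)) *+ 2 by ring.
by rewrite mulrn_wge0// subr_ge0.
Qed.

Let hsum_normZ (l : R[i]) (p : hsum) : hsum_norm (l *: p) = `|l| * hsum_norm p.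
Proof.
rewrite /hsum_norm/= !normrZ !exprMn -mulrDr.
by rewrite sqrtCM ?nnegrE ?exprn_ge0// sqrCK.
Qed.

Let hsum_norm_eq0 (p : hsum) : hsum_norm p = 0 -> p = 0.
Proof.
move/eqP; rewrite sqrtC_eq0 paddr_eq0 ?exprn_ge0// !expf_eq0/= !normr_eq0.
by case: p => x y /= /andP[/eqP-> /eqP->].
Qed.

HB.instance Definition _ :=
  Lmodule_isNormed.Build R[i] hsum hsum_normD hsum_normZ hsum_norm_eq0.

Lemma hsum_normE (p : hsum) : `|p| = sqrtC (`|p.1| ^+ 2 + `|p.2| ^+ 2).
Proof. by []. Qed.

Lemma ler_norm_fst (p : hsum) : `|p.1| <= `|p|.
Proof.
rewrite hsum_normE -[leLHS](sqrCK (normr_ge0 _)) ler_sqrtC ?nnegrE ?exprn_ge0//.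
by rewrite lerDl exprn_ge0.
Qed.

Lemma ler_norm_snd (p : hsum) : `|p.2| <= `|p|.
Proof.
rewrite hsum_normE -[leLHS](sqrCK (normr_ge0 _)) ler_sqrtC ?nnegrE ?exprn_ge0//.
by rewrite lerDr exprn_ge0.
Qed.

Lemma ler_hsum_norm (p : hsum) : `|p| <= `|p.1| + `|p.2|.
Proof.
have s0 : 0 <= `|p.1| + `|p.2| by rewrite addr_ge0.
rewrite hsum_normE -[leRHS](sqrCK s0) ler_sqrtC ?nnegrE ?exprn_ge0//.
by rewrite sqrrD addrAC lerDl mulrn_wge0// mulr_ge0.
Qed.

Let hsum_complete (F : set_system hsum) :
  ProperFilter F -> cauchy F -> cvg F.
Proof.
move=> FF /cauchy_ballP Fc.
have cvg1 : cvg ((fst : hsum -> U) @ F).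
  apply/cauchy_cvgP/cauchy_ballP => e e0; near_simpl.
  apply: filterS (Fc _ e0) => -[p q]; rewrite -!ball_normE/=.
  exact: le_lt_trans (ler_norm_fst (p - q)).
have cvg2 : cvg ((snd : hsum -> V) @ F).
  apply/cauchy_cvgP/cauchy_ballP => e e0; near_simpl.
  apply: filterS (Fc _ e0) => -[p q]; rewrite -!ball_normE/=.
  exact: le_lt_trans (ler_norm_snd (p - q)).
move/cvg_ex : cvg1 => [/= x /cvgrPdist_lt Fx].
move/cvg_ex : cvg2 => [/= y /cvgrPdist_lt Fy].
apply/cvg_ex; exists ((x, y) : hsum); apply/cvgrPdist_lt => e e0.
have e20 : 0 < e / 2 by rewrite divr_gt0.
apply: filterS2 (Fx _ e20) (Fy _ e20) => p p1 p2.
apply: le_lt_trans (ler_hsum_norm _) _.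
by rewrite [ltRHS]splitr; exact: ltrD.
Qed.

HB.instance Definition _ := Uniform_isComplete.Build hsum hsum_complete.

Let hsum_inner_bilinear :
  bilinear_for (GRing.Scale.Law.clone _ _ *%R _)
    (GRing.Scale.Law.clone _ _ (@Num.conj R[i] \; *%R) _) hsum_inner.
Proof.
split=> [q|p] k u v; rewrite /hsum_inner/=.
  by rewrite !linearPl/= [in RHS]mulrDr addrACA.
by rewrite !linearPr/= [in RHS]mulrDr addrACA.
Qed.

HB.instance Definition _ :=
  bilinear_isBilinear.Build R[i] hsum hsum R[i] _ _ hsum_inner
    hsum_inner_bilinear.

Let hsum_inner_hermitian (p q : hsum) :
  hsum_inner p q = (-1) ^+ false * Num.conj (hsum_inner q p).
Proof.
rewrite /hsum_inner expr0 mul1r rmorphD/=.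
by congr (_ + _); rewrite [LHS]hermC expr0 mul1r.
Qed.

HB.instance Definition _ :=
  isHermitianSesquilinear.Build R[i] hsum false (@Num.conj R[i]) hsum_inner
    hsum_inner_hermitian.

Let hsum_sqr_norm (p : hsum) : `|p| ^+ 2 = hsum_inner p p.
Proof. by rewrite hsum_normE sqrtCK !sqr_norm_inner. Qed.

Let hsum_inner_gt0 (p : hsum) : p != 0 -> 0 < hsum_inner p p.
Proof. by move=> p0; rewrite -hsum_sqr_norm exprn_gt0// normr_gt0. Qed.

HB.instance Definition _ :=
  isDotProduct.Build R[i] hsum hsum_inner hsum_inner_gt0.

HB.instance Definition _ :=
  @CompleteNormedModule_isHilbert.Build R hsum
    (hsum_inner : {dot hsum for @Num.conj R[i]}) hsum_sqr_norm.

Lemma hsum_innerE (p q : hsum) : inner p q = inner p.1 q.1 + inner p.2 q.2.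
Proof. by []. Qed.

End HilbertSum.

Record bounded_op (R : realType) (K : hilbertType R) := BoundedOp {
  op_fun :> {linear K -> K};
  op_bounded : exists M : R, forall x, rnorm (op_fun x) <= M * rnorm x
}.

Section Norms.
Variables (R : realType) (K : hilbertType R).

Definition op_norm (T : bounded_op K) : R :=
  sup [set rnorm (T x) | x in [set x : K | rnorm x <= 1]].

(* On the zero space the index set is empty and sup set0 = 0, in accordance
   with the fact that the zero operator has norm 0. *)
Definition alpha_norm (alpha : R) (T : bounded_op K) : R :=
  sup [set Num.sqrt (alpha * rnorm (inner (T x) x) ^+ 2 +
                     (1 - alpha) * rnorm (T x) ^+ 2)
      | x in [set x : K | rnorm x = 1]].

Let zero_op_bounded :
  exists M : R, forall x : K, rnorm ((\0 : {linear K -> K}) x) <= M * rnorm x.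
Proof. by exists 0 => x; rewrite mul0r /rnorm normr0. Qed.

Definition zero_op : bounded_op K := BoundedOp zero_op_bounded.

End Norms.
Arguments zero_op {R K}.

Section BlockOperator.
Variables (R : realType) (H : hilbertType R) (A B C D : bounded_op H).

Definition block_fun (p : hsum H H) : hsum H H :=
  (A p.1 + B p.2, C p.1 + D p.2).

Let block_fun_linear : linear block_fun.
Proof.
move=> k p q; rewrite /block_fun/= !linearP/=.
by congr pair => /=; rewrite scalerDr addrACA.
Qed.

HB.instance Definition _ :=
  GRing.isLinear.Build R[i] (hsum H H) (hsum H H) _ block_fun block_fun_linear.

Let block_fun_bounded :
  exists M : R, forall p, rnorm (block_fun p) <= M * rnorm p.
Proof.
have bnd (T : bounded_op H) :
    exists2 M : R, 0 <= M & forall x, rnorm (T x) <= M * rnorm x.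
  have [M TM] := op_bounded T; exists `|M| => // x.
  by apply: le_trans (TM x) _; rewrite ler_wpM2r ?rnorm_ge0 ?ler_norm.
have [[a a0 Aa] [b b0 Bb]] := (bnd A, bnd B).
have [[c c0 Cc] [d d0 Dd]] := (bnd C, bnd D).
exists (a + b + (c + d)) => p.
have p1 : rnorm p.1 <= rnorm p by rewrite -lecR !rnormE; exact: ler_norm_fst.
have p2 : rnorm p.2 <= rnorm p by rewrite -lecR !rnormE; exact: ler_norm_snd.
have le_row (T S : bounded_op H) (t s : R) : 0 <= t -> 0 <= s ->
    (forall x, rnorm (T x) <= t * rnorm x) ->
    (forall x, rnorm (S x) <= s * rnorm x) ->
    rnorm (T p.1 + S p.2) <= (t + s) * rnorm p.
  move=> t0 s0 Tt Ss; apply: le_trans (ler_rnormD _ _) _.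
  rewrite mulrDl; apply: lerD.
    by apply: le_trans (Tt _) _; rewrite ler_wpM2l.
  by apply: le_trans (Ss _) _; rewrite ler_wpM2l.
apply: (@le_trans _ _ (rnorm (block_fun p).1 + rnorm (block_fun p).2)).
  by rewrite -lecR rmorphD/= !rnormE; exact: ler_hsum_norm.
by rewrite mulrDl; apply: lerD; apply: le_row.
Qed.

(* The operator matrix with rows (A, B) and (C, D). *)
Definition block_op : bounded_op (hsum H H) := BoundedOp block_fun_bounded.

End BlockOperator.

(* Main.v *)
Require Import Defs.
From HB Require Import structures.
From mathcomp Require Import all_boot all_order all_algebra.
From mathcomp.real_closed Require Import complex.
From mathcomp Require Import all_classical all_reals all_analysis.
From mathcomp Require Import ring lra.

Set Implicit Arguments.
Unset Strict Implicit.
Unset Printing Implicit Defensive.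

Import Order.TTheory GRing.Theory Num.Theory.
Import numFieldNormedType.Exports.
Local Open Scope ring_scope.

(** Write [p = (x, y)] for a vector of [H + H].  The block operator sends [p] to
    [(X y, 0)], so the quantity under the square root is
    [alpha * |<X y, x>|^2 + (1 - alpha) * |X y|^2].  By Cauchy-Schwarz and
    [|X y| <= |X| * |y|], on the unit sphere, where [|x|^2 = 1 - |y|^2], it is
    at most [|X|^2 * t * (1 - alpha * t)] with [t = |y|^2].  Both inequalities
    can be made as tight as desired at once and for any prescribed [t]: take [y]
    almost maximising [|X y| / |y|] and [x] parallel to [X y].  The norm is
    therefore [|X|] times the square root of the maximum of the parabola
    [t * (1 - alpha * t)] over [[0, 1]].  The vertex [1 / (2 * alpha)] lies in
    that interval exactly when [alpha >= 1/2], which gives the maximum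
    [1 / (4 * alpha)]; otherwise the parabola increases on [[0, 1]] and the
    maximum is its value [1 - alpha] at [t = 1].

    The two inequalities between the norms are [alpha_norm_corner_le], which
    rests on [rnorm_inner_le] and [rnorm_le_op_norm], and [corner_attained]; the
    parabola is treated in [parabola_le] and [parabola_attained]. *)

(** * Norms and inner products *)

Lemma sqr_rnormE (R : realType) (V : normedZmodType R[i]) (x : V) :
  (rnorm x ^+ 2)%:C%C = `|x| ^+ 2.
Proof. by rewrite -rnormE -rmorphXn. Qed.

Section Hilbert.
Variables (R : realType) (K : hilbertType R).

Lemma rnormZ (a : R) (x : K) : rnorm (a%:C%C *: x) = `|a| * rnorm x.
Proof.
apply: complexI; rewrite rmorphM/= !rnormE normrZ; congr (_ * _).
by rewrite normc_def/= expr0n/= addr0 sqrtr_sqr.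
Qed.

Lemma rnorm_eq0 (x : K) : (rnorm x == 0) = (x == 0).
Proof. by rewrite -(inj_eq (@complexI _)) rnormE normr_eq0. Qed.

Lemma innerZl (a : R[i]) (x y : K) : inner (a *: x) y = a * inner x y.
Proof. exact: linearZl_LR. Qed.

Lemma innerZr (a : R[i]) (x y : K) : inner x (a *: y) = a^* * inner x y.
Proof. exact: linearZr_LR. Qed.

Lemma innerBl (x y z : K) : inner (x - y) z = inner x z - inner y z.
Proof. exact: linearBl. Qed.

Lemma innerBr (x y z : K) : inner x (y - z) = inner x y - inner x z.
Proof. exact: linearBr. Qed.

Lemma innerC (x y : K) : inner y x = (inner x y)^*.
Proof. by rewrite [LHS]hermC expr0 mul1r. Qed.

(** Cauchy-Schwarz, read off from [|w|^2 >= 0] for [w = |y|^2 x - <x, y> y]: this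
    is the component of [x] orthogonal to [y], scaled by [|y|^2] so that its
    square norm [|y|^2 * (|x|^2 * |y|^2 - |<x, y>|^2)] involves no quotient. *)
Lemma rnorm_inner_le (x y : K) : rnorm (inner x y) <= rnorm x * rnorm y.
Proof.
have [->|y0] := eqVneq y 0.
  by rewrite linear0r /rnorm !normr0 mulr0.
rewrite -(@ler_pXn2r _ 2) ?nnegrE ?mulr_ge0 ?rnorm_ge0// -lecR.
have -> : ((rnorm x * rnorm y) ^+ 2)%:C%C = `|x| ^+ 2 * `|y| ^+ 2.
  by rewrite exprMn -!sqr_rnormE -rmorphM.
rewrite sqr_rnormE.
set N := `|y| ^+ 2; set c := inner x y.
have N0 : 0 < N by rewrite exprn_gt0// normr_gt0.
have Nr : N^* = N by apply/CrealP; rewrite realE ltW.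
have := exprn_ge0 2 (normr_ge0 (N *: x - c *: y)).
rewrite sqr_norm_inner innerBl !innerBr !innerZl !innerZr (innerC x y).
rewrite -/c -!sqr_norm_inner -/N Nr normCK.
have -> : N * (N * `|x| ^+ 2) - N * (c^* * c) - (c * (N * c^*) - c * (c^* * N)) =
  N * (`|x| ^+ 2 * N - c * c^*) by ring.
by rewrite pmulr_rge0// subr_ge0.
Qed.

Lemma op_norm_has_ubound (T : bounded_op K) :
  has_ubound [set rnorm (T x) | x in [set x : K | rnorm x <= 1]]%classic.
Proof.
have [M TM] := op_bounded T; exists `|M| => _ [x /= x1 <-].
apply: le_trans (TM x) _; apply: (@le_trans _ _ (`|M| * rnorm x)).
  by rewrite ler_wpM2r ?rnorm_ge0 ?ler_norm.
by rewrite ler_piMr.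
Qed.

Lemma op_norm_ge0 (T : bounded_op K) : 0 <= op_norm T.
Proof.
apply: (@le_trans _ _ (rnorm (T 0))); first exact: rnorm_ge0.
apply: (ub_le_sup (op_norm_has_ubound T)); exists 0 => //=.
by rewrite /rnorm normr0 ler01.
Qed.

Lemma rnorm_le_op_norm (T : bounded_op K) (x : K) :
  rnorm (T x) <= op_norm T * rnorm x.
Proof.
have [->|x0] := eqVneq x 0.
  by rewrite linear0 /rnorm !normr0 mulr0.
have nx : 0 < rnorm x by rewrite lt_def rnorm_eq0 x0 rnorm_ge0.
rewrite -ler_pdivrMr//; apply: (ub_le_sup (op_norm_has_ubound T)).
exists ((rnorm x)^-1%:C%C *: x) => /=.
  by rewrite rnormZ ger0_norm ?invr_ge0 ?rnorm_ge0// mulVf ?gt_eqF.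
by rewrite linearZ rnormZ ger0_norm ?invr_ge0 ?rnorm_ge0// mulrC.
Qed.

End Hilbert.

Lemma sqr_rnorm_hsum (R : realType) (U V : hilbertType R) (p : hsum U V) :
  rnorm p ^+ 2 = rnorm p.1 ^+ 2 + rnorm p.2 ^+ 2.
Proof.
by apply: complexI; rewrite rmorphD/= !rmorphXn/= !rnormE hsum_normE sqrtCK.
Qed.

(** * Maximising the parabola *)

Section Parabola.
Variables (R : realType) (alpha : R).

(** The square root of the maximum over [[0, 1]] of [t * (1 - alpha * t)]. *)
Definition corner_const : R :=
  if 1 / 2 < alpha then 1 / (2 * Num.sqrt alpha) else Num.sqrt (1 - alpha).

Lemma corner_const_gt0 : 0 < corner_const.
Proof.
rewrite /corner_const; case: (ltP (1 / 2) alpha) => a2.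
  by rewrite divr_gt0 ?ltr01// mulr_gt0 ?ltr0n// sqrtr_gt0; lra.
by rewrite sqrtr_gt0; lra.
Qed.

Lemma sqr_corner_const :
  corner_const ^+ 2 = if 1 / 2 < alpha then 1 / (4 * alpha) else 1 - alpha.
Proof.
rewrite /corner_const; case: (ltP (1 / 2) alpha) => a2; last by rewrite sqr_sqrtr; lra.
rewrite expr_div_n exprMn sqr_sqrtr; last by lra.
by rewrite expr1n -natrX.
Qed.

Lemma parabola_le (t : R) : 0 <= t <= 1 ->
  t * (1 - alpha * t) <= corner_const ^+ 2.
Proof.
move=> t01; rewrite sqr_corner_const; case: (ltP (1 / 2) alpha) => a2.
  rewrite ler_pdivlMr; last by lra.
  by have := sqr_ge0 (2 * alpha * t - 1); nra.
rewrite -subr_ge0.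
have -> : 1 - alpha - t * (1 - alpha * t) =
  (1 - t) * (1 - alpha - alpha * t) by ring.
by apply: mulr_ge0; nra.
Qed.

Lemma parabola_attained :
  exists2 t, 0 < t <= 1 & t * (1 - alpha * t) = corner_const ^+ 2.
Proof.
rewrite sqr_corner_const; case: (ltP (1 / 2) alpha) => a2.
  have a0 : 0 < alpha by lra.
  (* the vertex, at most 1 because alpha > 1/2 *)
  exists (1 / (2 * alpha)); last by field; rewrite gt_eqF.
  by rewrite divr_gt0 ?mulr_gt0//= ler_pdivrMr ?mulr_gt0//; lra.
by exists 1; [rewrite ltr01 lexx|rewrite mul1r mulr1].
Qed.

End Parabola.

(** * Operator matrices with a single off-diagonal entry *)

Section Corner.
Variables (R : realType) (H : hilbertType R) (alpha : R).
Hypothesis alpha01 : 0 <= alpha <= 1.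
Variable X : bounded_op H.

Let C := block_op zero_op X zero_op zero_op.
Let f (p : hsum H H) := Num.sqrt (alpha * rnorm (inner (C p) p) ^+ 2 +
  (1 - alpha) * rnorm (C p) ^+ 2).

Lemma cornerE (p : hsum H H) : C p = (X p.2, 0).
Proof. by congr pair; rewrite [LHS]add0r. Qed.

Lemma rnorm_corner (p : hsum H H) : rnorm (C p) = rnorm (X p.2).
Proof.
apply/eqP; rewrite -(@eqrXn2 _ 2) ?rnorm_ge0//; apply/eqP.
by rewrite cornerE sqr_rnorm_hsum [rnorm _.2]/rnorm normr0 expr0n addr0.
Qed.

Lemma inner_corner (p : hsum H H) : inner (C p) p = inner (X p.2) p.1.
Proof. by rewrite cornerE hsum_innerE [inner _.2 _]linear0l addr0. Qed.

(** Bounding [|<X y, x>|] by [|X y| * |x|] before bounding [|X y|] leaves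
    [|X y|^2 * (1 - alpha * |y|^2)], so that [|X|] is applied only once, with a
    nonnegative factor. *)
Lemma corner_le (p : hsum H H) : rnorm p = 1 ->
  f p <= corner_const alpha * op_norm X.
Proof.
move=> p1; have /andP[a0 a1] := alpha01.
have N0 := op_norm_ge0 X; have c0 := corner_const_gt0 alpha.
have := sqr_rnorm_hsum p; rewrite p1 expr1n => p12.
rewrite /f rnorm_corner inner_corner.
rewrite -[leRHS]ger0_norm ?mulr_ge0 ?(ltW c0)// -sqrtr_sqr ler_wsqrtr//.
have xy := rnorm_inner_le (X p.2) p.1; have Xy := rnorm_le_op_norm X p.2.
have xy2 : rnorm (inner (X p.2) p.1) ^+ 2 <= (rnorm (X p.2) * rnorm p.1) ^+ 2.
  by rewrite ler_pXn2r ?nnegrE ?mulr_ge0 ?rnorm_ge0.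
have Xy2 : rnorm (X p.2) ^+ 2 <= (op_norm X * rnorm p.2) ^+ 2.
  by rewrite ler_pXn2r ?nnegrE ?mulr_ge0 ?rnorm_ge0.
set t := rnorm p.2 ^+ 2 in p12 *.
have p1E : rnorm p.1 ^+ 2 = 1 - t by rewrite p12 addrK.
have t01 : 0 <= t <= 1 by rewrite sqr_ge0 -subr_ge0 -p1E sqr_ge0.
rewrite exprMn p1E in xy2; rewrite exprMn -/t in Xy2.
have at0 : 0 <= 1 - alpha * t by rewrite subr_ge0; nra.
apply: (@le_trans _ _ (rnorm (X p.2) ^+ 2 * (1 - alpha * t))).
  by have := ler_wpM2l a0 xy2; lra.
apply: le_trans (ler_wpM2r at0 Xy2) _.
rewrite -mulrA [leRHS]exprMn mulrC ler_wpM2r ?sqr_ge0//.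
exact: parabola_le.
Qed.

Lemma alpha_norm_corner_le : alpha_norm alpha C <= corner_const alpha * op_norm X.
Proof.
rewrite /alpha_norm.
set S := (X in sup X); have [S0|/set0P[s Ss]] := eqVneq S set0.
  by rewrite S0 sup0 mulr_ge0 ?op_norm_ge0 ?(ltW (corner_const_gt0 alpha)).
apply: ge_sup; first by exists s.
by move=> _ [p /= p1 <-]; exact: corner_le.
Qed.

Lemma le_alpha_norm_corner (p : hsum H H) : rnorm p = 1 -> f p <= alpha_norm alpha C.
Proof.
move=> p1; apply: ub_le_sup; last by exists p.
by exists (corner_const alpha * op_norm X) => _ [q /= q1 <-]; exact: corner_le.
Qed.

Lemma alpha_norm_corner_ge0 : 0 <= alpha_norm alpha C.
Proof.
have [S0|/set0P[p p1]] := eqVneq [set p : hsum H H | rnorm p = 1]%classic set0.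
  (* On the zero space the supremum is over the empty set, hence 0. *)
  by rewrite /alpha_norm S0 image_set0 sup0.
exact: le_trans (sqrtr_ge0 _) (le_alpha_norm_corner p1).
Qed.

(** For [t] maximising the parabola, normalise [y] to length [sqrt t] and put
    [X y], rescaled to length [sqrt (1 - t)], in the other component; then
    Cauchy-Schwarz is an equality. *)
Lemma corner_attained (y : H) : X y != 0 ->
  exists2 p : hsum H H, rnorm p = 1 &
    f p = corner_const alpha * (rnorm (X y) / rnorm y).
Proof.
move=> Xy0; have [t /andP[t0 t1] tc] := parabola_attained alpha.
have y0 : y != 0 by apply: contra_neq Xy0 => ->; rewrite linear0.
have ny : 0 < rnorm y by rewrite lt_def rnorm_eq0 y0 rnorm_ge0.
have nXy : 0 < rnorm (X y) by rewrite lt_def rnorm_eq0 Xy0 rnorm_ge0.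
set a := Num.sqrt (1 - t) / rnorm (X y); set b := Num.sqrt t / rnorm y.
have a0 : 0 <= a by rewrite divr_ge0 ?sqrtr_ge0 ?rnorm_ge0.
have b0 : 0 <= b by rewrite divr_ge0 ?sqrtr_ge0 ?rnorm_ge0.
have aE : (a * rnorm (X y)) ^+ 2 = 1 - t.
  by rewrite divfK ?gt_eqF// sqr_sqrtr// subr_ge0.
have bE : (b * rnorm y) ^+ 2 = t by rewrite divfK ?gt_eqF// sqr_sqrtr// ltW.
exists (a%:C%C *: X y, b%:C%C *: y).
  apply/eqP; rewrite -(@eqrXn2 _ 2) ?rnorm_ge0 ?ler01// sqr_rnorm_hsum/=.
  by rewrite !rnormZ !ger0_norm// aE bE subrK expr1n.
have c0 := corner_const_gt0 alpha.
rewrite /f rnorm_corner inner_corner/= (linearZ _ _ : X (_ *: y) = _ *: X y).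
rewrite -[RHS]ger0_norm; last by rewrite !mulr_ge0 ?invr_ge0 ?ltW.
rewrite -sqrtr_sqr; congr Num.sqrt.
have -> : rnorm (inner (b%:C%C *: X y) (a%:C%C *: X y)) = b * a * rnorm (X y) ^+ 2.
  apply: complexI; rewrite innerZl innerZr rnormE !normrM norm_conjC.
  rewrite -sqr_norm_inner !ger0_norm ?lecR ?exprn_ge0// -sqr_rnormE.
  by rewrite -!rmorphM mulrA.
rewrite rnormZ ger0_norm// [RHS]exprMn -tc.
have b2 : b ^+ 2 = t / rnorm y ^+ 2.
  by rewrite expr_div_n sqr_sqrtr// ltW.
have -> : (b * a * rnorm (X y) ^+ 2) ^+ 2 =
  b ^+ 2 * (a * rnorm (X y)) ^+ 2 * rnorm (X y) ^+ 2 by ring.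
by rewrite aE [(b * _) ^+ 2]exprMn b2; field; rewrite gt_eqF.
Qed.

Lemma alpha_norm_corner_ge :
  corner_const alpha * op_norm X <= alpha_norm alpha C.
Proof.
have c0 := corner_const_gt0 alpha.
rewrite mulrC -ler_pdivlMr//; apply: ge_sup.
  by exists (rnorm (X 0)); exists 0 => //=; rewrite /rnorm normr0 ler01.
move=> _ [y /= y1 <-]; rewrite ler_pdivlMr//.
have [->|Xy0] := eqVneq (X y) 0.
  by rewrite [rnorm 0]/rnorm normr0 mul0r alpha_norm_corner_ge0.
have [p p1 fp] := corner_attained Xy0.
apply: le_trans (le_alpha_norm_corner p1); rewrite fp mulrC ler_wpM2l ?(ltW c0)//.
have y0 : y != 0 by apply: contra_neq Xy0 => ->; rewrite linear0.
have ny : 0 < rnorm y by rewrite lt_def rnorm_eq0 y0 rnorm_ge0.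
by rewrite ler_pdivlMr// ler_piMr// rnorm_ge0.
Qed.

End Corner.

Theorem theorem2p3 (R : realType) (H : hilbertType R) (alpha : R)
    (alpha01 : 0 <= alpha <= 1) (X : bounded_op H) :
  alpha_norm alpha (block_op zero_op X zero_op zero_op) =
    if 1 / 2 < alpha then 1 / (2 * Num.sqrt alpha) * op_norm X
    else Num.sqrt (1 - alpha) * op_norm X.
Proof.
transitivity (corner_const alpha * op_norm X).
  by apply/le_anti; rewrite alpha_norm_corner_le//= alpha_norm_corner_ge.
by rewrite /corner_const; case: ifP.
Qed.
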